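(* Suppose the functions $\varphi_k : (0,1) \to \mathbb{R}$ satisfy for every $k \in \mathbb{N}$ the following conditions. 1. Each $\varphi_k$ is a computable function. 2. $\varphi_k$ is a $C^1$-function, i.e., continuously differentiable. 3. The set $\{x \in \mathbb{R} : \varphi_k'(x) = 0\}$ is finite and its number of elements and their values are computable. Then there exists an algorithm computing an $x \in (0,1)$ such that all $\varphi_k(x)$ are non-normal.
   Context: Here $(\varphi_k)_{k\in\mathbb{N}}$ is a countable family of functions on $(0,1)$, and $\varphi_k'$ denotes the derivative of $\varphi_k$, defined on the domain $(0,1)$. Computability is understood in the usual sense: a real number is computable if there is an algorithm which, given $n$, outputs a rational within $2^{-n}$ of it; a function is computable if there is an algorithm which, given arbitrarily good rational approximations of $x$ and given $n$, outputs a rational within $2^{-n}$ of the function value at $x$. For an integer base $b\ge2$, a real number $x$ is $b$-normal if every finite word $w$ over $\{0,\dots,b-1\}$ appears with asymptotic frequency $b^{-|w|}$ in the $b$-ary expansion of $x$, where $|w|$ is the length of $w$ (the expansion is made unique by using a finite expansion, i.e. one with only finitely many nonzero digits, whenever possible). A real number is normal if it is $b$-normal for every integer $b\ge2$, and non-normal otherwise.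
   Formalization: Conditions 1 and 3 are taken uniformly in k (one algorithm receiving k as input); if each φ_k is only separately computable the claim fails, e.g. for the family of all translations x+c with c a computable real. *)

(* Defs.v *)
From Stdlib Require Import Reals QArith Qreals ZArith Arith List Cantor.
From Coquelicot Require Import Coquelicot.
Import ListNotations.
Open Scope R_scope.

Notation "⟨ a , b ⟩" := (Cantor.to_nat (a, b)) (at level 0).

(* Codes for partial recursive functions from nat to nat, relative to an
   oracle.  Several arguments are passed through Cantor's pairing. *)
Inductive code : Type :=
| Zero | Succ | Fst | Snd | Oracle
| Pair (f g : code)
| Comp (f g : code)
| Prec (f g : code)
| Mu (f : code).

(* [eval o c n m]: the program [c] with oracle [o] halts on input [n] with
   output [m].  In [eval_Mu], [r] records that [f] halts with a nonzero value
   on all candidates below the root [n]. *)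
Inductive eval (o : nat -> nat) : code -> nat -> nat -> Prop :=
| eval_Zero n : eval o Zero n 0%nat
| eval_Succ n : eval o Succ n (S n)
| eval_Fst n : eval o Fst n (fst (Cantor.of_nat n))
| eval_Snd n : eval o Snd n (snd (Cantor.of_nat n))
| eval_Oracle n : eval o Oracle n (o n)
| eval_Pair f g n a b :
    eval o f n a -> eval o g n b -> eval o (Pair f g) n ⟨a, b⟩
| eval_Comp f g n a b :
    eval o g n a -> eval o f a b -> eval o (Comp f g) n b
| eval_Prec_O f g a b :
    eval o f a b -> eval o (Prec f g) ⟨a, 0%nat⟩ b
| eval_Prec_S f g a i r b :
    eval o (Prec f g) ⟨a, i⟩ r -> eval o g ⟨a, ⟨i, r⟩⟩ b ->
    eval o (Prec f g) ⟨a, S i⟩ b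
| eval_Mu f a n (r : nat -> nat) :
    eval o f ⟨a, n⟩ 0%nat ->
    (forall i, (i < n)%nat -> eval o f ⟨a, i⟩ (S (r i))) ->
    eval o (Mu f) a n.

(* The zero oracle carries no information: this is plain computability. *)
Definition run : code -> nat -> nat -> Prop := eval (fun _ => 0%nat).

(* Surjective numbering of the rationals: ⟨⟨a, b⟩, d⟩ stands for
   (a - b) / (d + 1). *)
Definition rat_of_nat (m : nat) : Q :=
  let (s, d) := Cantor.of_nat m in
  let (a, b) := Cantor.of_nat s in
  Qmake (Z.of_nat a - Z.of_nat b) (Pos.of_succ_nat d).

Definition approximates (m n : nat) (x : R) : Prop :=
  Rabs (Q2R (rat_of_nat m) - x) <= / 2 ^ n.

Definition computable_real (x : R) : Prop :=
  exists c, forall n, exists m, run c n m /\ approximates m n x.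

(* One algorithm serves all [k], and it must succeed for every oracle
   delivering rational approximations of [x].  Only the restrictions of the
   [phi k] to (0,1) matter. *)
Definition computable_functions (phi : nat -> R -> R) : Prop :=
  exists c, forall (k : nat) (x : R), 0 < x < 1 ->
    forall o : nat -> nat, (forall n, approximates (o n) n x) ->
    forall n, exists m, eval o c ⟨k, n⟩ m /\ approximates m n (phi k x).

Definition C1_on_unit_interval (f : R -> R) : Prop :=
  forall x, 0 < x < 1 -> ex_derive f x /\ continuous (Derive f) x.

(* Each [A k] is finite; its cardinality is computable from [k], and the
   [i]-th element of a repetition-free enumeration is computable from [k]
   and [i]. *)
Definition computable_finite_sets (A : nat -> R -> Prop) : Prop :=
  exists l : nat -> list R,
    (forall k, NoDup (l k) /\ forall x, In x (l k) <-> A k x) /\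
    (exists c, forall k, run c k (length (l k))) /\
    (exists c, forall k i, (i < length (l k))%nat ->
       forall n, exists m,
         run c ⟨⟨k, i⟩, n⟩ m /\ approximates m n (nth i (l k) 0)).

(* The [i]-th digit after the radix point.  Negative numbers carry a sign, so
   digits are read off |x|; [Int_part] (floor) gives the terminating expansion
   whenever there is one. *)
Definition digit (b : nat) (x : R) (i : nat) : nat :=
  Z.to_nat (Z.modulo (Int_part (Rabs x * INR b ^ S i)) (Z.of_nat b)).

Definition occurs_at (b : nat) (x : R) (w : list nat) (i : nat) : bool :=
  if list_eq_dec Nat.eq_dec (map (digit b x) (seq i (length w))) w
  then true else false.

Definition occurrences (b : nat) (x : R) (w : list nat) (N : nat) : nat :=
  length (filter (occurs_at b x w) (seq 0 N)).

(* The finitely many digits of the integer part do not affect asymptotic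
   frequencies and are left out of the count. *)
Definition b_normal (b : nat) (x : R) : Prop :=
  forall w : list nat, List.Forall (fun d => (d < b)%nat) w ->
    is_lim_seq (fun N => INR (occurrences b x w N) / INR N)
               (Finite (/ INR b ^ length w)).

Definition normal (x : R) : Prop :=
  forall b : nat, (2 <= b)%nat -> b_normal b x.

(* Main.v *)
From Stdlib Require Import Reals Qreals ZArith Arith List Cantor Wf_nat.
From Stdlib Require Import Lia Lra Classical IndefiniteDescription.
From Coquelicot Require Import Coquelicot.
Require Import Defs.
Import ListNotations.
Open Scope R_scope.

(** The proof is an effective Baire category argument.

    A real [y] fails to be normal in base 2 as soon as, for infinitely many
    [N], its binary digits at places [N] to [4N-1] all vanish: the frequency of
    the digit 0 among the first [4N] digits is then at least 3/4 infinitely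
    often ([near_dyadics_not_normal]).  The absolute values of the [y] with
    such a block of zeros form the interval from [z/2^N] to
    [z/2^N + 2^(-4N)], for some natural [z].  For each [j], the union of these
    intervals over [z] and over [N > j] contains a dense open set.  Since
    [phi k] has finitely many critical points, it is constant on no interval,
    so by the intermediate value theorem its values hit that open set inside
    every subinterval of (0,1) ([near_dyadic_values_dense]).

    An [x] good for all pairs [(k, j)] is thus the common point of nested
    balls, the ball chosen at stage [(k, j)] being mapped by [phi k] into one
    of the intervals above with [N > j].  For [x] to be computable, the choice
    has to be made by a search with a decidable test, so a program must be able
    to certify an estimate of [phi k] on a whole ball, knowing only an algorithm
    for [phi k].  This is [effective_continuity]: run the algorithm at a rational
    point [p], answering each query by [p] itself, and record a bound [u] on the
    queries ([track]).  For a real [y] within [2^(-u)] of [p], those answers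
    are also correct approximations of [y], so the output is an approximation
    of [phi k y] too.

    Certifying an estimate on a candidate ball then takes finitely many
    comparisons of natural numbers ([ball_test]), and unbounded search followed
    by primitive recursion yields the sequence of balls. *)

(** * Programs and their determinism *)

Local Open Scope nat_scope.

Lemma eval_Prec_inv o f g a i m :
  eval o (Prec f g) ⟨a, i⟩ m ->
  match i with
  | 0 => eval o f a m
  | S j => exists r, eval o (Prec f g) ⟨a, j⟩ r /\ eval o g ⟨a, ⟨j, r⟩⟩ m
  end.
Proof.
  remember ⟨a, i⟩ as n eqn:E. intros H. inversion H; subst n; clear H;
    match goal with H : Cantor.to_nat _ = Cantor.to_nat _ |- _ =>
      apply Cantor.to_nat_inj in H; injection H as -> <- end; eauto.
Qed.

Lemma eval_functional o c n m m' : eval o c n m -> eval o c n m' -> m = m'.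
Proof.
  intros H. revert m'.
  induction H as [n|n|n|n|n|f g n a b _ IHf _ IHg|f g n a b _ IHg _ IHf
    |f g a b _ IH|f g a i r b _ IHr _ IHg|f a n r _ IH0 _ IHr]; intros m' H';
    try (inversion H'; subst; clear H'; reflexivity).
  - inversion H' as [| | | | |f' g' n' a' b' Hf Hg| | | |]; subst.
    now rewrite (IHf _ Hf), (IHg _ Hg).
  - inversion H' as [| | | | | |f' g' n' a' b' Hg Hf| | |]; subst.
    rewrite <- (IHg _ Hg) in Hf. auto.
  - apply eval_Prec_inv in H'. auto.
  - apply eval_Prec_inv in H'. destruct H' as [r' [Hr Hg]].
    rewrite <- (IHr _ Hr) in Hg. auto.
  - inversion H' as [| | | | | | | | |f' a' n' r' H0 Hr]; subst.
    destruct (lt_eq_lt_dec n m') as [[L|E]|L]; trivial.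
    + specialize (IH0 _ (Hr n L)). discriminate.
    + specialize (IHr _ L _ H0). discriminate.
Qed.

Lemma eval_Fst_pair o a b : eval o Fst ⟨a, b⟩ a.
Proof.
  pose proof (eval_Fst o ⟨a, b⟩) as H. now rewrite Cantor.cancel_of_to in H.
Qed.

Lemma eval_Snd_pair o a b : eval o Snd ⟨a, b⟩ b.
Proof.
  pose proof (eval_Snd o ⟨a, b⟩) as H. now rewrite Cantor.cancel_of_to in H.
Qed.

Local Opaque Cantor.to_nat Cantor.of_nat.

Definition Id : code := Pair Fst Snd.

Lemma eval_Id o n : eval o Id n n.
Proof.
  rewrite <- (Cantor.cancel_to_of n) at 2.
  rewrite (surjective_pairing (Cantor.of_nat n)).
  apply eval_Pair; [apply eval_Fst|apply eval_Snd].
Qed.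

Definition Add : code := Prec Id (Comp Succ (Comp Snd Snd)).

Lemma eval_Add o a b : eval o Add ⟨a, b⟩ (a + b).
Proof.
  induction b as [|b IH].
  - rewrite Nat.add_0_r. apply eval_Prec_O, eval_Id.
  - rewrite Nat.add_succ_r. eapply eval_Prec_S; [exact IH|].
    repeat (eapply eval_Comp; try apply eval_Snd_pair). apply eval_Succ.
Qed.

Ltac evaluate :=
  repeat first
    [ eassumption
    | apply eval_Fst_pair | apply eval_Snd_pair | apply eval_Id
    | apply eval_Add | apply eval_Zero | apply eval_Succ
    | eapply eval_Comp | eapply eval_Pair ].

(** [Prec] and [Mu] let only the right component of their input vary, so the
    parameter [p] of a tracked program is kept in the left one and has to be
    moved back in front before the program is called. *)
Definition Under (c : code) : code :=
  Comp c (Pair (Comp Fst Fst) (Pair (Comp Snd Fst) Snd)).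

Lemma eval_Under o c p a i m :
  eval o c ⟨p, ⟨a, i⟩⟩ m -> eval o (Under c) ⟨⟨p, a⟩, i⟩ m.
Proof. intros H. unfold Under. evaluate. Qed.

(** * Bounding the oracle queries of a program *)

(** Oracle-free simulation of [c]: on input [⟨p, n⟩] it runs [c] on [n] with
    every query answered by [p], and returns the result together with a number
    exceeding all queries made.  The bound for several calls is the sum of
    their bounds.  In the [Mu] case, the root is searched for first, and the
    bounds of the calls below and at the root are added up afterwards. *)
Fixpoint track (c : code) : code :=
  match c with
  | Oracle => Pair Fst (Comp Succ Snd)
  | Pair f g =>
      Pair (Pair (Comp Fst (track f)) (Comp Fst (track g)))
           (Comp Add (Pair (Comp Snd (track f)) (Comp Snd (track g))))
  | Comp f g =>
      let h := Comp (track f) (Pair Fst (Comp Fst (track g))) in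
      Pair (Comp Fst h) (Comp Add (Pair (Comp Snd h) (Comp Snd (track g))))
  | Prec f g =>
      let last := Under (track g) in
      let h := Comp last
        (Pair Fst (Pair (Comp Fst Snd) (Comp Fst (Comp Snd Snd)))) in
      Comp (Prec (track f)
             (Pair (Comp Fst h)
                (Comp Add (Pair (Comp Snd h) (Comp Snd (Comp Snd Snd))))))
           (Pair (Pair Fst (Comp Fst Snd)) (Comp Snd Snd))
  | Mu f =>
      let h := Under (track f) in
      let root := Mu (Comp Fst h) in
      let uses := Prec Zero
        (Comp Add (Pair (Comp Snd (Comp h (Pair Fst (Comp Fst Snd))))
                        (Comp Snd Snd))) in
      Pair root (Comp uses (Pair Id (Comp Succ root)))
  | c => Pair (Comp c Snd) Zero
  end.

(** A computation depends only on the answers that it receives, so any oracle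
    agreeing with the constant one below [u] leads to the same result. *)
Theorem track_correct p c n m :
  eval (fun _ => p) c n m ->
  exists u, run (track c) ⟨p, n⟩ ⟨m, u⟩ /\
    forall o, (forall i, i < u -> o i = p) -> eval o c n m.
Proof.
  unfold run. intros H.
  induction H as [n|n|n|n|n|f g n a b _ [v [Ef Uf]] _ [w [Eg Ug]]
    |f g n a b _ [w [Eg Ug]] _ [v [Ef Uf]]
    |f g a b _ [v [Ef Uf]]
    |f g a i r b _ [v [Ef Uf]] _ [w [Eg Ug]]
    |f a n r _ IH0 _ IHr]; simpl track.
  - exists 0. split; [evaluate|]. intros. apply eval_Zero.
  - exists 0. split; [evaluate|]. intros. apply eval_Succ.
  - exists 0. split; [evaluate; apply eval_Fst|]. intros. apply eval_Fst.
  - exists 0. split; [evaluate; apply eval_Snd|]. intros. apply eval_Snd.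
  - exists (S n). split; [evaluate|]. intros o Ho.
    rewrite <- (Ho n (Nat.lt_succ_diag_r n)). apply eval_Oracle.
  - exists (v + w). split; [evaluate|]. intros o Ho.
    apply eval_Pair; [apply Uf|apply Ug]; intros; apply Ho; lia.
  - exists (v + w). split; [evaluate|]. intros o Ho.
    apply (eval_Comp _ _ _ _ a); [apply Ug|apply Uf]; intros; apply Ho; lia.
  - exists v. split.
    + eapply eval_Comp; [evaluate|]. apply eval_Prec_O, Ef.
    + intros o Ho. apply eval_Prec_O, Uf, Ho.
  - exists (w + v). simpl track in Ef. split.
    + eapply eval_Comp; [evaluate|]. eapply eval_Prec_S.
      (* The simulation of [Prec f g] rearranges its input before the inner
         recursion: the run on [i] given by induction yields, by determinism,
         a run of the inner recursion. *)
      * inversion Ef as [| | | | | |f' g' n' a' b' E1 E2| | |]; subst.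
        assert (E : eval (fun _ => 0) (Pair (Pair Fst (Comp Fst Snd)) (Comp Snd Snd))
          ⟨p, ⟨a, i⟩⟩ ⟨⟨p, a⟩, i⟩) by evaluate.
        rewrite (eval_functional _ _ _ _ _ E1 E) in E2. exact E2.
      * unfold Under. evaluate.
    + intros o Ho. apply (eval_Prec_S _ _ _ _ _ r).
      * apply Uf. intros; apply Ho; lia.
      * apply Ug. intros; apply Ho; lia.
  - set (h := Under (track f)).
    (* [v i] is the value of [f] on the candidate [i], for all [i] up to the
       root [n]. *)
    set (v i := if i <? n then S (r i) else 0).
    assert (Hv : forall i, i < S n -> exists u,
        eval (fun _ => 0) h ⟨⟨p, a⟩, i⟩ ⟨v i, u⟩ /\
        forall o, (forall i, i < u -> o i = p) -> eval o f ⟨a, i⟩ (v i)).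
    { intros i Hi. unfold v. destruct (Nat.ltb_spec i n) as [L|L].
      - destruct (IHr i L) as [u [E U]]. exists u.
        split; [apply eval_Under, E|exact U].
      - replace i with n by lia. destruct IH0 as [u [E U]]. exists u.
        split; [apply eval_Under, E|exact U]. }
    assert (Hroot : eval (fun _ => 0) (Mu (Comp Fst h)) ⟨p, a⟩ n).
    { apply (eval_Mu _ _ _ _ r).
      - destruct (Hv n) as [u [E _]]; [lia|]. unfold v in E.
        rewrite Nat.ltb_irrefl in E. evaluate.
      - intros i Hi. destruct (Hv i) as [u [E _]]; [lia|]. unfold v in E.
        rewrite (proj2 (Nat.ltb_lt i n) Hi) in E. evaluate. }
    set (uses := Prec Zero _).
    assert (Huses : forall j, j <= S n -> exists u,
        eval (fun _ => 0) uses ⟨⟨p, a⟩, j⟩ u /\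
        forall o, (forall i, i < u -> o i = p) ->
          forall i, i < j -> eval o f ⟨a, i⟩ (v i)).
    { induction j as [|j IH]; intros Hj.
      - exists 0. split; [apply eval_Prec_O, eval_Zero|]. intros; lia.
      - destruct IH as [u [E U]]; [lia|].
        destruct (Hv j Hj) as [u' [E' U']]. exists (u' + u). split.
        + eapply eval_Prec_S; [exact E|]. evaluate.
        + intros o Ho i Hi. destruct (Nat.eq_dec i j) as [->|].
          * apply U'. intros; apply Ho; lia.
          * apply U; [intros; apply Ho|]; lia. }
    destruct (Huses (S n) (le_n _)) as [u [E U]].
    exists u. split; [evaluate|]. intros o Ho. apply (eval_Mu _ _ _ _ r).
    + specialize (U o Ho n). unfold v in U. rewrite Nat.ltb_irrefl in U.
      apply U. lia.
    + intros i Hi. specialize (U o Ho i). unfold v in U.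
      rewrite (proj2 (Nat.ltb_lt i n) Hi) in U. apply U. lia.
Qed.

(** * Computable functions on the natural numbers *)

Definition computable (f : nat -> nat) : Prop :=
  exists c, forall n, run c n (f n).

Definition unl (n : nat) : nat := fst (Cantor.of_nat n).
Definition unr (n : nat) : nat := snd (Cantor.of_nat n).

Lemma unl_pair a b : unl ⟨a, b⟩ = a.
Proof. unfold unl. now rewrite Cantor.cancel_of_to. Qed.

Lemma unr_pair a b : unr ⟨a, b⟩ = b.
Proof. unfold unr. now rewrite Cantor.cancel_of_to. Qed.

Lemma pair_unl_unr n : ⟨unl n, unr n⟩ = n.
Proof.
  unfold unl, unr. now rewrite <- surjective_pairing, Cantor.cancel_to_of.
Qed.

Lemma computable_id : computable (fun n => n).
Proof. exists Id. intros n. apply eval_Id. Qed.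

Lemma computable_const k : computable (fun _ => k).
Proof.
  induction k as [|k [c H]].
  - exists Zero. intros n. apply eval_Zero.
  - exists (Comp Succ c). intros n.
    exact (eval_Comp _ _ _ _ _ _ (H n) (eval_Succ _ _)).
Qed.

Lemma computable_comp f g :
  computable f -> computable g -> computable (fun n => f (g n)).
Proof.
  intros [c H] [d K]. exists (Comp c d). intros n.
  exact (eval_Comp _ _ _ _ _ _ (K n) (H _)).
Qed.

Lemma computable_S f : computable f -> computable (fun n => S (f n)).
Proof. apply (computable_comp S). exists Succ. intros n. apply eval_Succ. Qed.

Lemma computable_unl f : computable f -> computable (fun n => unl (f n)).
Proof. apply (computable_comp unl). exists Fst. intros n. apply eval_Fst. Qed.

Lemma computable_unr f : computable f -> computable (fun n => unr (f n)).
Proof. apply (computable_comp unr). exists Snd. intros n. apply eval_Snd. Qed.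

Lemma computable_pair f g :
  computable f -> computable g -> computable (fun n => ⟨f n, g n⟩).
Proof.
  intros [c H] [d K]. exists (Pair c d). intros n.
  exact (eval_Pair _ _ _ _ _ _ (H n) (K n)).
Qed.

Lemma computable_rec f g h k :
  (forall n,
     nat_rect (fun _ => nat) (f n) (fun i r => g ⟨n, ⟨i, r⟩⟩) (h n) = k n) ->
  computable f -> computable g -> computable h -> computable k.
Proof.
  intros Hk [c Hf] [d Hg] [e Hh].
  exists (Comp (Prec c d) (Pair Id e)). intros n. rewrite <- Hk.
  eapply eval_Comp; [exact (eval_Pair _ _ _ _ _ _ (eval_Id _ n) (Hh n))|].
  induction (h n) as [|i IH]; simpl.
  - apply eval_Prec_O, Hf.
  - exact (eval_Prec_S _ _ _ _ _ _ _ IH (Hg _)).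
Qed.

Create HintDb computability.
#[local] Hint Resolve computable_id computable_const computable_S computable_unl
  computable_unr computable_pair : computability.

Lemma computable_add f g :
  computable f -> computable g -> computable (fun n => f n + g n).
Proof.
  intros Hf Hg.
  apply (computable_rec f (fun w => S (unr (unr w))) g).
  - intros n. induction (g n) as [|i IH]; simpl; [|rewrite !unr_pair]; lia.
  all: auto with computability.
Qed.

Lemma computable_pred f : computable f -> computable (fun n => pred (f n)).
Proof.
  intros Hf.
  apply (computable_rec (fun _ => 0) (fun w => unl (unr w)) f).
  - intros n. destruct (f n); simpl; [|rewrite unr_pair, unl_pair]; lia.
  all: auto with computability.
Qed.

#[local] Hint Resolve computable_add computable_pred : computability.

Lemma computable_sub f g :
  computable f -> computable g -> computable (fun n => f n - g n).
Proof.
  intros Hf Hg.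
  apply (computable_rec f (fun w => pred (unr (unr w))) g).
  - intros n. induction (g n) as [|i IH]; simpl; [|rewrite !unr_pair]; lia.
  all: auto with computability.
Qed.

Lemma computable_mul f g :
  computable f -> computable g -> computable (fun n => f n * g n).
Proof.
  intros Hf Hg.
  apply (computable_rec (fun _ => 0) (fun w => unr (unr w) + f (unl w)) g).
  - intros n. induction (g n) as [|i IH]; simpl;
      [|rewrite !unr_pair, !unl_pair]; lia.
  - auto with computability.
  - apply computable_add; auto with computability.
    apply computable_comp; auto with computability.
  - exact Hg.
Qed.

#[local] Hint Resolve computable_sub computable_mul : computability.

Lemma computable_pow k f : computable f -> computable (fun n => k ^ f n).
Proof.
  intros Hf.
  apply (computable_rec (fun _ => 1) (fun w => k * unr (unr w)) f).
  - intros n. induction (f n) as [|i IH]; simpl; [|rewrite !unr_pair, IH]; lia.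
  all: auto with computability.
Qed.

Lemma computable_iter s0 step :
  computable step ->
  computable (nat_rect (fun _ => nat) s0 (fun i s => step ⟨i, s⟩)).
Proof.
  intros H.
  apply (computable_rec (fun _ => s0) (fun w => step (unr w)) (fun n => n)).
  - intros n. generalize n at 1 as k. intros k.
    induction n as [|i IH]; simpl; [|rewrite unr_pair, IH]; reflexivity.
  - auto with computability.
  - apply computable_comp; auto with computability.
  - auto with computability.
Qed.

(** The value of [g] is the least zero, since that is the one [Mu] finds. *)
Lemma computable_search test :
  computable test -> (forall a, exists n, test ⟨a, n⟩ = 0) ->
  exists g, computable g /\ forall a, test ⟨a, g a⟩ = 0.
Proof.
  intros [c Hc] Hex.
  assert (Hmin : forall a, exists n,
      test ⟨a, n⟩ = 0 /\ forall i, i < n -> test ⟨a, i⟩ <> 0).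
  { intros a.
    destruct (dec_inh_nat_subset_has_unique_least_element
      (fun n => test ⟨a, n⟩ = 0)) as [n [[H0 Hle] _]].
    - intros n. destruct (Nat.eq_dec (test ⟨a, n⟩) 0); auto.
    - apply Hex.
    - exists n. split; trivial. intros i Hi E. specialize (Hle i E). lia. }
  destruct (functional_choice _ Hmin) as [g Hg].
  exists g. split; [|intros a; apply Hg].
  exists (Mu c). intros a. destruct (Hg a) as [H0 Hpos].
  apply (eval_Mu _ _ _ _ (fun i => pred (test ⟨a, i⟩))).
  - generalize (Hc ⟨a, g a⟩). rewrite H0. trivial.
  - intros i Hi. rewrite Nat.succ_pred by (apply Hpos, Hi). apply Hc.
Qed.

#[local] Hint Resolve computable_pow : computability.

(** * Rational points of the unit interval *)

Definition absdiff (a b : nat) : nat := (a - b) + (b - a).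

(** Every natural number [⟨a, b⟩] is made to stand for the rational
    [(a + 1) / (a + b + 2)].  These are exactly the rationals of (0,1), so the
    algorithm for [phi] halts at every point and no code needs to be excluded
    from a search. *)
Definition num (p : nat) : nat := S (unl p).
Definition den (p : nat) : nat := S (num p + unr p).
Definition point_code (p : nat) : nat := ⟨⟨num p, 0⟩, num p + unr p⟩.

Lemma computable_absdiff f g :
  computable f -> computable g -> computable (fun n => absdiff (f n) (g n)).
Proof. intros Hf Hg. unfold absdiff. auto with computability. Qed.

Lemma computable_num f : computable f -> computable (fun n => num (f n)).
Proof. intros Hf. unfold num. auto with computability. Qed.

#[local] Hint Resolve computable_absdiff computable_num : computability.

Lemma computable_den f : computable f -> computable (fun n => den (f n)).
Proof. intros Hf. unfold den. auto 6 with computability. Qed.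

Lemma computable_point_code : computable point_code.
Proof. unfold point_code. auto 7 with computability. Qed.

#[local] Hint Resolve computable_den : computability.

Local Open Scope R_scope.

Definition point (p : nat) : R := INR (num p) / INR (den p).

Lemma INR_S_pos n : 0 < INR (S n).
Proof. apply lt_0_INR. lia. Qed.

Lemma pow2_pos n : 0 < 2 ^ n.
Proof. apply pow_lt. lra. Qed.

Lemma INR_pow2 n : INR (2 ^ n) = 2 ^ n.
Proof. now rewrite pow_INR. Qed.

Lemma inv_pow2_S n : / 2 ^ S n = / 2 ^ n / 2.
Proof. simpl. field. apply Rgt_not_eq, pow2_pos. Qed.

Lemma inv_pow2_le m n : (m <= n)%nat -> / 2 ^ n <= / 2 ^ m.
Proof.
  intros H. apply Rinv_le_contravar; [apply pow2_pos|].
  apply Rle_pow; [lra|exact H].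
Qed.

Lemma inv_pow2_small eps j :
  0 < eps -> exists n, (j <= n)%nat /\ / 2 ^ n < eps.
Proof.
  intros He. destruct (pow_lt_1_zero (/ 2)) with (y := eps) as [n Hn]; trivial.
  { rewrite Rabs_pos_eq; lra. }
  exists (j + n)%nat. split; [lia|]. specialize (Hn (j + n)%nat ltac:(lia)).
  rewrite <- pow_inv. apply Rle_lt_trans with (2 := Hn), Rle_abs.
Qed.

Lemma INR_absdiff a b : INR (absdiff a b) = Rabs (INR a - INR b).
Proof.
  unfold absdiff. destruct (le_lt_dec a b) as [H|H].
  - replace ((a - b) + (b - a))%nat with (b - a)%nat by lia.
    rewrite minus_INR, Rabs_left1; trivial; [lra|]. apply le_INR in H. lra.
  - replace ((a - b) + (b - a))%nat with (a - b)%nat by lia.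
    rewrite minus_INR, Rabs_pos_eq; trivial; [|lia]. apply lt_INR in H. lra.
Qed.

Lemma Q2R_rat_of_nat a b d :
  Q2R (rat_of_nat ⟨⟨a, b⟩, d⟩) = (INR a - INR b) / INR (S d).
Proof.
  unfold rat_of_nat. rewrite !Cantor.cancel_of_to. unfold Q2R. simpl Qnum.
  simpl Qden. rewrite minus_IZR, <- 2!INR_IZR_INZ.
  change (Z.pos (Pos.of_succ_nat d)) with (Z.of_nat (S d)).
  now rewrite <- INR_IZR_INZ.
Qed.

Lemma Q2R_point_code p : Q2R (rat_of_nat (point_code p)) = point p.
Proof.
  unfold point_code. rewrite Q2R_rat_of_nat, INR_0, Rminus_0_r. reflexivity.
Qed.

Lemma point_in_unit_interval p : 0 < point p < 1.
Proof.
  unfold point, den. split.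
  - apply Rdiv_lt_0_compat; apply INR_S_pos.
  - apply Rmult_lt_reg_r with (INR (S (num p + unr p))).
    + apply INR_S_pos.
    + unfold Rdiv. rewrite Rmult_assoc, Rinv_l, Rmult_1_l, Rmult_1_r.
      * apply lt_INR. lia.
      * apply Rgt_not_eq, INR_S_pos.
Qed.

(** Numerator [⌊yD⌋ + 1] over a denominator [D] so large that the numerator
    stays below it. *)
Lemma point_dense y eps :
  0 < y < 1 -> 0 < eps -> exists p, Rabs (point p - y) < eps.
Proof.
  intros Hy He.
  destruct (archimed_cor1 (Rmin eps (1 - y))) as [D [HD HD0]].
  { apply Rmin_case; lra. }
  assert (HDe := Rlt_le_trans _ _ _ HD (Rmin_l _ _)).
  assert (HDy := Rlt_le_trans _ _ _ HD (Rmin_r _ _)).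
  apply lt_0_INR in HD0.
  destruct (nfloor_ex (y * INR D)) as [a [Ha1 Ha2]].
  { apply Rmult_le_pos; lra. }
  assert (HaD : (S a < D)%nat).
  { apply INR_lt. rewrite S_INR. apply Rmult_lt_compat_r with (r := INR D) in HDy; trivial.
    rewrite Rinv_l in HDy; lra. }
  exists ⟨a, (D - S (S a))%nat⟩.
  unfold point, den, num. rewrite !unl_pair, unr_pair.
  replace (S (S a + (D - S (S a))))%nat with D by lia.
  rewrite S_INR.
  replace ((INR a + 1) / INR D - y) with ((INR a + 1 - y * INR D) * / INR D) by (field; lra).
  rewrite Rabs_pos_eq.
  - apply Rle_lt_trans with (2 := HDe). rewrite <- (Rmult_1_l (/ INR D)) at 2.
    apply Rmult_le_compat_r; [apply Rlt_le, Rinv_0_lt_compat|]; lra.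
  - apply Rmult_le_pos; [|apply Rlt_le, Rinv_0_lt_compat]; lra.
Qed.

(** * Certified estimates on balls *)

Lemma approximable y :
  0 < y < 1 -> exists o : nat -> nat, forall n, approximates (o n) n y.
Proof.
  intros Hy. apply (functional_choice (fun n m => approximates m n y)).
  intros n. destruct (point_dense y (/ 2 ^ n) Hy) as [p Hp].
  - apply Rinv_0_lt_compat, pow2_pos.
  - exists (point_code p). unfold approximates. rewrite Q2R_point_code. lra.
Qed.

(** The right component of [F ⟨p, ⟨k, n⟩⟩] is a bound on the queries of the
    algorithm run at the point [p], and therefore the exponent of a radius on
    which its output, the left component, remains valid.  The oracle for [y]
    used in the proof answers [p] up to that bound and switches to arbitrary
    approximations of [y] beyond; by determinism the algorithm cannot tell it
    from the constant oracle. *)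
Lemma effective_continuity phi :
  computable_functions phi ->
  exists F, computable F /\ forall p k n y, 0 < y < 1 ->
    Rabs (point p - y) <= / 2 ^ unr (F ⟨p, ⟨k, n⟩⟩) ->
    approximates (unl (F ⟨p, ⟨k, n⟩⟩)) n (phi k y).
Proof.
  intros [c Hc].
  destruct (computable_pair (fun w => point_code (unl w)) unr) as [d Hd].
  { apply computable_comp; auto using computable_point_code with computability. }
  { auto with computability. }
  assert (HF : forall w, exists v, run (Comp (track c) d) w v /\
    forall o, (forall i, (i < unr v)%nat -> o i = point_code (unl w)) ->
      eval o c (unr w) (unl v)).
  { intros w. destruct (Hc (unl (unr w)) (point (unl w))) with
      (o := fun _ : nat => point_code (unl w)) (n := unr (unr w)) as [m [Hm _]].
    - apply point_in_unit_interval.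
    - intros n. unfold approximates. rewrite Q2R_point_code, Rminus_diag, Rabs_R0.
      apply Rlt_le, Rinv_0_lt_compat, pow2_pos.
    - rewrite pair_unl_unr in Hm. apply track_correct in Hm.
      destruct Hm as [u [Hu Hm]]. exists ⟨m, u⟩. rewrite unl_pair, unr_pair.
      split; [|exact Hm]. exact (eval_Comp _ _ _ _ _ _ (Hd w) Hu). }
  destruct (functional_choice _ HF) as [F Hw]. exists F. split.
  { exists (Comp (track c) d). intros w. apply Hw. }
  intros p k n y Hy. destruct (Hw ⟨p, ⟨k, n⟩⟩) as [_ Ho].
  revert Ho. generalize (F ⟨p, ⟨k, n⟩⟩) as v. intros v Ho Hv.
  rewrite unl_pair, unr_pair in Ho.
  destruct (approximable y Hy) as [o' Ho'].
  set (o i := if (i <? unr v)%nat then point_code p else o' i).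
  destruct (Hc k y Hy o) with (n := n) as [m [Hm Am]].
  - intros i. unfold o. destruct (Nat.ltb_spec i (unr v)) as [L|L]; trivial.
    unfold approximates. rewrite Q2R_point_code.
    apply Rle_trans with (1 := Hv), inv_pow2_le. lia.
  - enough (unl v = m) as -> by exact Am. apply (eval_functional o c ⟨k, n⟩); trivial.
    apply Ho. intros i Hi. unfold o. now rewrite (proj2 (Nat.ltb_lt _ _) Hi).
Qed.

(** * The decidable test for the next ball *)

(** The binary digits of [y] at places [N] to [4N-1] all vanish, [z] being
    the part of [|y| 2^N] before the radix point. *)
Definition near_dyadic (N z : nat) (y : R) : Prop :=
  INR z / 2 ^ N <= Rabs y < INR z / 2 ^ N + / 2 ^ (4 * N).

Definition abs_num (m : nat) : nat := absdiff (unl (unl m)) (unr (unl m)).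
Definition rat_den (m : nat) : nat := S (unr m).

Lemma Rabs_rat m :
  Rabs (Q2R (rat_of_nat m)) = INR (abs_num m) / INR (rat_den m).
Proof.
  rewrite <- (pair_unl_unr m), <- (pair_unl_unr (unl m)), Q2R_rat_of_nat.
  unfold abs_num, rat_den. rewrite !unl_pair, !unr_pair, INR_absdiff.
  unfold Rdiv. rewrite Rabs_mult. f_equal. apply Rabs_pos_eq.
  apply Rlt_le, Rinv_0_lt_compat, INR_S_pos.
Qed.

Lemma div_le_iff a b c d :
  0 < b -> 0 < d -> a / b <= c / d <-> a * d <= c * b.
Proof.
  intros Hb Hd. split; intros H.
  - apply Rmult_le_compat_r with (r := b * d) in H; [|apply Rlt_le, Rmult_lt_0_compat; trivial].
    field_simplify in H; lra.
  - apply Rmult_le_reg_r with (b * d); [apply Rmult_lt_0_compat; trivial|].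
    field_simplify; lra.
Qed.

Lemma div_lt_iff a b c d :
  0 < b -> 0 < d -> a / b < c / d <-> a * d < c * b.
Proof.
  intros Hb Hd. split; intros H; apply Rnot_le_lt; intros H';
    apply (Rlt_not_le _ _ H), div_le_iff; trivial.
Qed.

Lemma le_iff_INR a b : (a <= b)%nat <-> INR a <= INR b.
Proof. split; [apply le_INR|apply INR_le]. Qed.

Lemma lt_iff_INR a b : (a < b)%nat <-> INR a < INR b.
Proof. split; [apply lt_INR|apply INR_lt]. Qed.

Lemma near_dyadic_lower_test m n N z :
  ((z * 2 ^ n + 2 ^ N) * rat_den m <= abs_num m * 2 ^ (n + N))%nat <->
  INR z / 2 ^ N + / 2 ^ n <= Rabs (Q2R (rat_of_nat m)).
Proof.
  rewrite Rabs_rat, le_iff_INR, !mult_INR, plus_INR, mult_INR, !INR_pow2, pow_add.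
  assert (Hn := pow2_pos n). assert (HN := pow2_pos N).
  replace (INR z / 2 ^ N + / 2 ^ n) with ((INR z * 2 ^ n + 2 ^ N) / (2 ^ n * 2 ^ N))
    by (field; lra).
  rewrite div_le_iff; [tauto|now apply Rmult_lt_0_compat|apply INR_S_pos].
Qed.

Lemma near_dyadic_upper_test m n N z :
  ((abs_num m * 2 ^ n + rat_den m) * 2 ^ (4 * N)
    < (z * 2 ^ (3 * N) + 1) * (rat_den m * 2 ^ n))%nat <->
  Rabs (Q2R (rat_of_nat m)) + / 2 ^ n < INR z / 2 ^ N + / 2 ^ (4 * N).
Proof.
  rewrite Rabs_rat, lt_iff_INR, !mult_INR, !plus_INR, !mult_INR, !INR_pow2.
  replace (2 ^ (4 * N)) with (2 ^ N * 2 ^ (3 * N)) by (rewrite <- pow_add; f_equal; lia).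
  assert (Hn := pow2_pos n). assert (HN := pow2_pos N). assert (HM := pow2_pos (3 * N)).
  assert (Hd : 0 < INR (rat_den m)) by apply INR_S_pos.
  replace (INR (abs_num m) / INR (rat_den m) + / 2 ^ n) with
    ((INR (abs_num m) * 2 ^ n + INR (rat_den m)) / (INR (rat_den m) * 2 ^ n)) by (field; lra).
  replace (INR z / 2 ^ N + / (2 ^ N * 2 ^ (3 * N))) with
    ((INR z * 2 ^ (3 * N) + 1) / (2 ^ N * 2 ^ (3 * N))) by (field; lra).
  rewrite div_lt_iff; [tauto|now apply Rmult_lt_0_compat..].
Qed.

Lemma point_near_test p q e :
  (absdiff (num q * den p) (num p * den q) * 2 ^ e <= den p * den q)%nat <->
  Rabs (point q - point p) <= / 2 ^ e.
Proof.
  rewrite le_iff_INR, !mult_INR, INR_absdiff, !mult_INR, INR_pow2. unfold point.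
  assert (He := pow2_pos e).
  assert (Hs : 0 < INR (den p)) by apply INR_S_pos.
  assert (Hc : 0 < INR (den q)) by apply INR_S_pos.
  assert (Hsc := Rmult_lt_0_compat _ _ Hs Hc).
  replace (INR (num q) / INR (den q) - INR (num p) / INR (den p)) with
    ((INR (num q) * INR (den p) - INR (num p) * INR (den q)) * / (INR (den p) * INR (den q)))
    by (field; lra).
  rewrite Rabs_mult, (Rabs_pos_eq (/ _)) by (apply Rlt_le, Rinv_0_lt_compat; lra).
  rewrite <- (Rmult_1_l (/ 2 ^ e)).
  change (?a * / ?b) with (a / b). rewrite div_le_iff; trivial. lra.
Qed.

(** The input is [⟨⟨i, ⟨p, e⟩⟩, ⟨⟨q, d⟩, ⟨n, ⟨N, z⟩⟩⟩⟩]: the stage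
    [i = ⟨k, j⟩], the current ball with centre [p] and radius [2^(-e)], and a
    candidate ball with centre [q] and radius [2^(-d)] together with witnesses.
    A truncated difference vanishes exactly when an inequality holds, so the
    value is 0 when all six conditions of [ball_test_spec] hold. *)
Definition ball_test (F : nat -> nat) (w : nat) : nat :=
  let i := unl (unl w) in
  let p := unl (unr (unl w)) in let e := unr (unr (unl w)) in
  let q := unl (unl (unr w)) in let d := unr (unl (unr w)) in
  let n := unl (unr (unr w)) in let N := unl (unr (unr (unr w))) in
  let z := unr (unr (unr (unr w))) in
  let v := F ⟨q, ⟨unl i, n⟩⟩ in let m := unl v in
  ((S (unr i) - N) + (S e - d) + (unr v - d)
   + (absdiff (num q * den p) (num p * den q) * 2 ^ S e - den p * den q)
   + ((z * 2 ^ n + 2 ^ N) * rat_den m - abs_num m * 2 ^ (n + N))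
   + (S ((abs_num m * 2 ^ n + rat_den m) * 2 ^ (4 * N))
      - (z * 2 ^ (3 * N) + 1) * (rat_den m * 2 ^ n)))%nat.

Lemma computable_ball_test F : computable F -> computable (ball_test F).
Proof.
  intros HF.
  assert (HF' : forall f, computable f -> computable (fun n => F (f n)))
    by (intros; now apply computable_comp).
  unfold ball_test, abs_num, rat_den.
  repeat first
    [ assumption | apply computable_id | apply computable_const
    | apply computable_add | apply computable_sub | apply computable_mul
    | apply computable_pow | apply computable_absdiff | apply computable_num
    | apply computable_den
    | apply computable_unl | apply computable_unr | apply computable_pair
    | apply HF' | apply computable_S ].
Qed.

Lemma ball_test_spec F k j p e q d n N z :
  ball_test F ⟨⟨⟨k, j⟩, ⟨p, e⟩⟩, ⟨⟨q, d⟩, ⟨n, ⟨N, z⟩⟩⟩⟩ = 0%nat <->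
  (j < N)%nat /\ (e < d)%nat /\
  (unr (F ⟨q, ⟨k, n⟩⟩) <= d)%nat /\
  Rabs (point q - point p) <= / 2 ^ S e /\
  (let y := Q2R (rat_of_nat (unl (F ⟨q, ⟨k, n⟩⟩))) in
   INR z / 2 ^ N + / 2 ^ n <= Rabs y /\
   Rabs y + / 2 ^ n < INR z / 2 ^ N + / 2 ^ (4 * N)).
Proof.
  cbv zeta.
  rewrite <- near_dyadic_lower_test, <- near_dyadic_upper_test, <- point_near_test.
  unfold ball_test. cbv zeta. repeat first [rewrite unl_pair|rewrite unr_pair].
  generalize (F ⟨q, ⟨k, n⟩⟩) as v. intros v.
  rewrite !Nat.eq_add_0, !Nat.sub_0_le. unfold lt. tauto.
Qed.

(** * Blocks of zeros and normality *)

Lemma near_dyadic_digit N z y i :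
  near_dyadic N z y -> (N <= i < 4 * N)%nat -> digit 2 y i = 0%nat.
Proof.
  intros [Hlo Hhi] Hi. unfold digit.
  assert (HN := pow2_pos N).
  replace (INR 2) with 2 by reflexivity.
  replace (2 ^ S i) with (2 ^ N * 2 ^ (S i - N)) by (rewrite <- pow_add; f_equal; lia).
  set (P := 2 ^ (S i - N)). assert (HP : 0 < P) by apply pow2_pos.
  (* Multiplying by [2^(i+1)] with [i < 4N] blows the interval up to length at
     most 1, so the integer part is [z 2^(i+1-N)], which is even. *)
  assert (Hfrac : / 2 ^ (4 * N) * (2 ^ N * P) <= 1).
  { unfold P. rewrite <- pow_add. replace (N + (S i - N))%nat with (S i) by lia.
    rewrite <- (Rinv_l (2 ^ (4 * N))) by apply Rgt_not_eq, pow2_pos.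
    apply Rmult_le_compat_l; [apply Rlt_le, Rinv_0_lt_compat, pow2_pos|].
    apply Rle_pow; [lra|lia]. }
  assert (HNP : 0 < 2 ^ N * P) by now apply Rmult_lt_0_compat.
  assert (Hz : INR z / 2 ^ N * (2 ^ N * P) = INR (z * 2 ^ (S i - N))).
  { rewrite mult_INR, INR_pow2. fold P. field. lra. }
  apply Rmult_le_compat_r with (r := 2 ^ N * P) in Hlo; [|lra].
  apply Rmult_lt_compat_r with (r := 2 ^ N * P) in Hhi; [|lra].
  rewrite Rmult_plus_distr_r in Hhi. rewrite Hz in Hlo, Hhi.
  rewrite INR_IZR_INZ in Hlo, Hhi.
  replace (Int_part (Rabs y * (2 ^ N * P))) with (Z.of_nat (z * 2 ^ (S i - N))).
  - rewrite <- Znat.Nat2Z.inj_mod, Znat.Nat2Z.id.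
    replace (S i - N)%nat with (S (i - N)) by lia.
    rewrite Nat.pow_succ_r', (Nat.mul_comm 2), Nat.mul_assoc. apply Nat.Div0.mod_mul.
  - apply Int_part_spec. lra.
Qed.

Lemma occurrences_of_zero b y N :
  (forall i, (N <= i < 4 * N)%nat -> digit b y i = 0%nat) ->
  (3 * N <= occurrences b y [0%nat] (4 * N))%nat.
Proof.
  intros H. unfold occurrences. replace (4 * N)%nat with (N + 3 * N)%nat by lia.
  rewrite seq_app, filter_app, length_app, (forallb_filter_id _ (seq (0 + N) (3 * N))).
  - rewrite length_seq. lia.
  - apply forallb_forall. intros i Hi. apply in_seq in Hi. unfold occurs_at.
    change (map (digit b y) (seq i (length [0%nat]))) with [digit b y i].
    rewrite H by lia. now destruct (list_eq_dec Nat.eq_dec [0%nat] [0%nat]).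
Qed.

(** The word [[0]] would need frequency 1/2, but it has frequency at least 3/4
    among the first [4N] digits for arbitrarily large [N]. *)
Lemma near_dyadics_not_normal y :
  (forall j, exists N z, (j < N)%nat /\ near_dyadic N z y) -> ~ normal y.
Proof.
  intros H Hnorm.
  assert (Hlim := Hnorm 2%nat (le_n 2) [0%nat]).
  apply is_lim_seq_spec in Hlim; [|repeat constructor].
  destruct (Hlim (mkposreal (/ 4) ltac:(lra))) as [M HM]. simpl in HM.
  destruct (H M) as [N [z [HN Hnear]]].
  specialize (HM (4 * N)%nat ltac:(lia)).
  assert (Hocc : (3 * N <= occurrences 2 y [0%nat] (4 * N))%nat).
  { apply occurrences_of_zero. intros i. apply near_dyadic_digit with z, Hnear. }
  apply le_INR in Hocc. rewrite mult_INR in Hocc.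
  assert (H4 : INR (4 * N) = 4 * INR N) by (rewrite mult_INR; simpl; lra).
  assert (HN0 : 0 < INR N) by (apply lt_0_INR; lia).
  apply Rabs_def2 in HM.
  assert (Hge : 3 / 4 <= INR (occurrences 2 y [0%nat] (4 * N)) / INR (4 * N)).
  { rewrite H4. replace (INR 3) with 3 in Hocc by (simpl; lra).
    apply div_le_iff; lra. }
  simpl in HM, Hge. lra.
Qed.

(** * Density of the good values *)

(** Just to the right of a fraction [z/2^N] lying in the interval, which exists
    once [2^(-N)] is below its length.  Intervals of negative numbers are
    handled by symmetry. *)
Lemma near_dyadic_interior_dense j v1 v2 :
  v1 < v2 -> exists y N z, v1 < y < v2 /\ (j < N)%nat /\
    INR z / 2 ^ N < Rabs y < INR z / 2 ^ N + / 2 ^ (4 * N).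
Proof.
  assert (Hpos : forall v1 v2, 0 <= v1 < v2 -> exists y N z, v1 < y < v2 /\ (j < N)%nat /\
    INR z / 2 ^ N < Rabs y < INR z / 2 ^ N + / 2 ^ (4 * N)).
  { clear v1 v2. intros v1 v2 Hv.
    destruct (inv_pow2_small (v2 - v1) (S j)) as [N [HjN HN]]; [lra|].
    assert (HP := pow2_pos N).
    destruct (nfloor_ex (v1 * 2 ^ N)) as [a [Ha1 Ha2]]; [apply Rmult_le_pos; lra|].
    assert (Hz1 : v1 < INR (S a) / 2 ^ N).
    { rewrite S_INR. replace v1 with (v1 * 2 ^ N / 2 ^ N) by (field; lra).
      apply div_lt_iff; trivial. now apply Rmult_lt_compat_r. }
    assert (Hz2 : INR (S a) / 2 ^ N < v2).
    { apply Rle_lt_trans with (v1 + / 2 ^ N); [|lra].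
      replace (v1 + / 2 ^ N) with ((v1 * 2 ^ N + 1) / 2 ^ N) by (field; lra).
      rewrite S_INR. apply div_le_iff; trivial. apply Rmult_le_compat_r; lra. }
    assert (Hgap : 0 < / 2 ^ (4 * N)) by apply Rinv_0_lt_compat, pow2_pos.
    set (r := Rmin (v2 - INR (S a) / 2 ^ N) (/ 2 ^ (4 * N))).
    assert (Hr : 0 < r) by (apply Rmin_case; lra).
    assert (Hr1 := Rmin_l (v2 - INR (S a) / 2 ^ N) (/ 2 ^ (4 * N))).
    assert (Hr2 := Rmin_r (v2 - INR (S a) / 2 ^ N) (/ 2 ^ (4 * N))).
    fold r in Hr1, Hr2.
    exists (INR (S a) / 2 ^ N + r / 2), N, (S a).
    rewrite Rabs_pos_eq by lra. repeat split; try lra. lia. }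
  intros Hv. destruct (Rlt_le_dec 0 v2) as [H2|H2].
  - destruct (Hpos (Rmax v1 0) v2) as [y [N [z [Hy HNz]]]].
    { split; [apply Rmax_r|now apply Rmax_lub_lt]. }
    exists y, N, z. assert (Hm := Rmax_l v1 0). split; [lra|exact HNz].
  - destruct (Hpos (- v2) (- v1)) as [y [N [z [Hy HNz]]]]; [lra|].
    exists (- y), N, z. rewrite Rabs_Ropp. split; [lra|exact HNz].
Qed.

Lemma interval_avoids_list (l : list R) a b :
  a < b -> exists x, a < x < b /\ ~ In x l.
Proof.
  intros Hab.
  assert (H : exists a' b', a <= a' /\ a' < b' /\ b' <= b /\
    forall x, a' < x < b' -> ~ In x l).
  { induction l as [|c l [a' [b' [Ha [Hab' [Hb H]]]]]].
    - exists a, b. repeat split; auto; lra.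
    - destruct (Rlt_le_dec c b') as [Hc|Hc].
      + exists (Rmax a' c), b'. repeat split; trivial.
        * apply Rle_trans with (1 := Ha), Rmax_l.
        * now apply Rmax_lub_lt.
        * intros x Hx. assert (H1 := Rmax_l a' c). assert (H2 := Rmax_r a' c).
          intros [E|E]; [lra|]. apply (H x); [lra|exact E].
      + exists a', b'. repeat split; trivial.
        intros x Hx [E|E]; [lra|]. exact (H x Hx E). }
  destruct H as [a' [b' [Ha [Hab' [Hb H]]]]].
  exists ((a' + b') / 2). split; [lra|]. apply H. lra.
Qed.

Lemma nonconstant_near f x a b :
  a < x < b -> Derive f x <> 0 -> exists y, a < y < b /\ f y <> f x.
Proof.
  intros Hx Hd. apply NNPP. intros Hno. apply Hd.
  rewrite <- (Derive_const (f x) x). apply Derive_ext_loc.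
  assert (Hr : 0 < Rmin (x - a) (b - x)) by (apply Rmin_case; lra).
  exists (mkposreal _ Hr). intros y Hy. apply NNPP. intros Hf.
  apply Hno. exists y. split; trivial.
  change (Rabs (y - x) < Rmin (x - a) (b - x)) in Hy.
  apply Rabs_def2 in Hy.
  assert (H1 := Rmin_l (x - a) (b - x)). assert (H2 := Rmin_r (x - a) (b - x)). lra.
Qed.

Lemma intermediate_value f a b y :
  a < b -> (forall x, a <= x <= b -> continuity_pt f x) ->
  Rmin (f a) (f b) <= y <= Rmax (f a) (f b) -> exists x, a <= x <= b /\ f x = y.
Proof.
  intros Hab Hf. unfold Rmin, Rmax. destruct (Rle_dec (f a) (f b)) as [H|H]; intros Hy.
  - destruct (Ranalysis5.f_interv_is_interv f a b y) as [x Hx]; eauto.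
  - destruct (Ranalysis5.f_interv_is_interv (fun x => - f x) a b (- y)) as [x [Hx E]].
    + exact Hab.
    + lra.
    + intros x Hx. apply continuity_pt_opp. auto.
    + exists x. split; [exact Hx|]. lra.
Qed.

(** Away from the finite list of critical points, the function takes two
    different values inside [(a, b)], hence all values between them, and one of
    these is good.  The strict inequalities leave room for approximate
    evaluation at a nearby rational. *)
Lemma near_dyadic_values_dense f l j a b :
  0 <= a -> a < b -> b <= 1 ->
  (forall x, 0 < x < 1 -> ex_derive f x) ->
  (forall x, In x l <-> 0 < x < 1 /\ Derive f x = 0) ->
  exists x N z, a < x < b /\ (j < N)%nat /\
    INR z / 2 ^ N < Rabs (f x) < INR z / 2 ^ N + / 2 ^ (4 * N).
Proof.
  intros Ha Hab Hb Hder Hl.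
  assert (Hcont : forall x, 0 < x < 1 -> continuity_pt f x).
  { intros x Hx. apply continuity_pt_filterlim.
    exact (ex_derive_continuous f x (Hder x Hx)). }
  destruct (interval_avoids_list l a b Hab) as [x [Hx Hxl]].
  destruct (nonconstant_near f x a b Hx) as [x' [Hx' Hf]].
  { intros E. apply Hxl, Hl. split; [lra|exact E]. }
  destruct (near_dyadic_interior_dense j (Rmin (f x) (f x')) (Rmax (f x) (f x')))
    as [y [N [z [Hy HNz]]]].
  { unfold Rmin, Rmax. destruct (Rle_dec (f x) (f x')); lra. }
  assert (Hx0 : exists x0, a < x0 < b /\ f x0 = y).
  { destruct (Rtotal_order x x') as [Hlt|[E|Hlt]].
    - destruct (intermediate_value f x x' y) as [x0 [Hx0 E]]; trivial.
      + intros; apply Hcont; lra.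
      + lra.
      + exists x0. split; [lra|exact E].
    - subst. contradiction.
    - rewrite Rmin_comm, Rmax_comm in Hy.
      destruct (intermediate_value f x' x y) as [x0 [Hx0 E]]; trivial.
      + intros; apply Hcont; lra.
      + lra.
      + exists x0. split; [lra|exact E]. }
  destruct Hx0 as [x0 [Hx0 E]]. exists x0, N, z. rewrite E. auto.
Qed.

(** * Construction of the point *)

(** The second hypothesis says that each ball contains the next one.  The common
    point is the supremum of the left ends. *)
Lemma nested_balls (q r : nat -> R) :
  (forall i, 0 <= r i) ->
  (forall i, Rabs (q (S i) - q i) <= r i - r (S i)) ->
  exists x, forall i, Rabs (q i - x) <= r i.
Proof.
  intros Hr Hstep.
  assert (Hle : forall i d, Rabs (q (d + i)%nat - q i) <= r i - r (d + i)%nat).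
  { intros i d. induction d as [|d IH]; simpl.
    - rewrite Rminus_diag, Rabs_R0. lra.
    - replace (q (S (d + i)) - q i)
        with ((q (S (d + i)) - q (d + i)%nat) + (q (d + i)%nat - q i)) by ring.
      apply Rle_trans with (1 := Rabs_triang _ _). specialize (Hstep (d + i)%nat). lra. }
  assert (Hmeet : forall i j, q i - r i <= q j + r j).
  { intros i j. destruct (Nat.le_ge_cases i j) as [L|L].
    - specialize (Hle i (j - i)%nat). replace (j - i + i)%nat with j in Hle by lia.
      apply Rabs_le_between in Hle. specialize (Hr j). lra.
    - specialize (Hle j (i - j)%nat). replace (i - j + j)%nat with i in Hle by lia.
      apply Rabs_le_between in Hle. specialize (Hr i). lra. }
  destruct (completeness (fun y => exists i, y = q i - r i)) as [x [Hub Hlub]].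
  - exists (q 0%nat + r 0%nat). intros y [i ->]. apply Hmeet.
  - now exists (q 0%nat - r 0%nat), 0%nat.
  - exists x. intros i. apply Rabs_le_between. split.
    + assert (x <= q i + r i); [|lra]. apply Hlub. intros y [j ->]. apply Hmeet.
    + assert (q i - r i <= x); [|lra]. apply Hub. now exists i.
Qed.

(** The search for the next ball always succeeds, from every state: near a point
    [x] of the current ball at which [phi k] has a good value, pick a rational
    [q] so close that continuity leaves a margin [eta] around the value; [n] is
    chosen so that the errors of approximation fit into that margin.  Only then
    is the exponent of the new radius chosen, because the bound on the queries
    depends on [q] and [n]. *)
Lemma ball_test_satisfiable phi F l :
  (forall p k n y, 0 < y < 1 -> Rabs (point p - y) <= / 2 ^ unr (F ⟨p, ⟨k, n⟩⟩) ->
     approximates (unl (F ⟨p, ⟨k, n⟩⟩)) n (phi k y)) ->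
  (forall k x, 0 < x < 1 -> ex_derive (phi k) x) ->
  (forall k x, In x (l k) <-> 0 < x < 1 /\ Derive (phi k) x = 0) ->
  forall a, exists t, ball_test F ⟨a, t⟩ = 0%nat.
Proof.
  intros HF Hder Hl a.
  rewrite <- (pair_unl_unr a), <- (pair_unl_unr (unl a)), <- (pair_unl_unr (unr a)).
  generalize (unl (unl a)) (unr (unl a)) (unl (unr a)) (unr (unr a)).
  clear a. intros k j p e.
  assert (Hp := point_in_unit_interval p).
  assert (He : 0 < / 2 ^ S e) by apply Rinv_0_lt_compat, pow2_pos.
  set (a := Rmax 0 (point p - / 2 ^ S e)). set (b := Rmin 1 (point p + / 2 ^ S e)).
  assert (Ha0 : 0 <= a) by apply Rmax_l.
  assert (Ha1 : point p - / 2 ^ S e <= a) by apply Rmax_r.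
  assert (Hb0 : b <= 1) by apply Rmin_l.
  assert (Hb1 : b <= point p + / 2 ^ S e) by apply Rmin_r.
  assert (Hab : a < b).
  { unfold a, b. apply Rmax_lub_lt; apply Rmin_case; lra. }
  destruct (near_dyadic_values_dense (phi k) (l k) j a b) as [x [N [z [Hx [HN Hz]]]]];
    auto.
  set (lo := INR z / 2 ^ N) in *. set (hi := lo + / 2 ^ (4 * N)) in *.
  set (eta := Rmin (Rabs (phi k x) - lo) (hi - Rabs (phi k x))).
  assert (Heta : 0 < eta) by (apply Rmin_case; lra).
  assert (Heta1 : eta <= Rabs (phi k x) - lo) by apply Rmin_l.
  assert (Heta2 : eta <= hi - Rabs (phi k x)) by apply Rmin_r.
  assert (Hcont : continuous (phi k) x).
  { apply (ex_derive_continuous (phi k)), Hder. lra. }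
  destruct (proj1 (filterlim_locally _ _) Hcont (mkposreal (eta / 4) ltac:(lra)))
    as [delta Hdelta].
  set (rho := Rmin delta (Rmin (x - a) (b - x))).
  assert (Hrho : 0 < rho) by (repeat apply Rmin_case; try lra; apply cond_pos).
  assert (Hrho0 : rho <= delta) by apply Rmin_l.
  assert (Hrho' : rho <= Rmin (x - a) (b - x)) by apply Rmin_r.
  assert (Hrho1 := Rmin_l (x - a) (b - x)). assert (Hrho2 := Rmin_r (x - a) (b - x)).
  destruct (point_dense x rho) as [q Hq]; [lra|exact Hrho|].
  assert (Hphi : Rabs (phi k (point q) - phi k x) < eta / 4).
  { apply Hdelta. change (Rabs (point q - x) < delta). lra. }
  apply Rabs_def2 in Hq.
  destruct (inv_pow2_small (eta / 4) 0) as [n [_ Hn]]; [lra|].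
  set (v := F ⟨q, ⟨k, n⟩⟩).
  exists ⟨⟨q, (S e + unr v)%nat⟩, ⟨n, ⟨N, z⟩⟩⟩.
  apply ball_test_spec. fold v lo hi.
  assert (Hv : approximates (unl v) n (phi k (point q))).
  { apply HF; [apply point_in_unit_interval|]. rewrite Rminus_diag, Rabs_R0.
    apply Rlt_le, Rinv_0_lt_compat, pow2_pos. }
  unfold approximates in Hv. cbv zeta. set (y := Q2R _) in *.
  assert (Hy : Rabs (y - phi k x) < eta / 2).
  { replace (y - phi k x) with ((y - phi k (point q)) + (phi k (point q) - phi k x)) by ring.
    apply Rle_lt_trans with (1 := Rabs_triang _ _). lra. }
  assert (Hy1 := Rabs_triang_inv y (phi k x)).
  assert (Hy2 := Rabs_triang_inv (phi k x) y). rewrite Rabs_minus_sym in Hy2.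
  repeat split; try lia; try lra.
  apply Rabs_le. lra.
Qed.

Theorem corollary2p9 (phi : nat -> R -> R)
  (phi_computable : computable_functions phi)
  (phi_C1 : forall k, C1_on_unit_interval (phi k))
  (phi_critical : computable_finite_sets
     (fun k x => 0 < x < 1 /\ Derive (phi k) x = 0)) :
  exists x : R, 0 < x < 1 /\ computable_real x /\
    forall k, ~ normal (phi k x).
Proof.
  destruct (effective_continuity phi phi_computable) as [F [HF Hcont]].
  destruct phi_critical as [l [Hl _]].
  destruct (computable_search (ball_test F)) as [g [Hg Htest]].
  { apply computable_ball_test, HF. }
  { apply (ball_test_satisfiable phi F l Hcont).
    - intros k x Hx. apply phi_C1, Hx.
    - intros k. apply Hl. }
  (* The first ball has centre 1/2 and radius 1/4, so its closure lies within
     (0,1). *)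
  set (ball := nat_rect (fun _ => nat) ⟨⟨0%nat, 0%nat⟩, 2%nat⟩ (fun i s => unl (g ⟨i, s⟩))).
  assert (Hball : computable ball).
  { apply (computable_iter ⟨⟨0%nat, 0%nat⟩, 2%nat⟩ (fun w => unl (g w))), computable_unl, Hg. }
  assert (Hstep : forall k j, let i := ⟨k, j⟩ in exists n N z,
    let p := unl (ball (S i)) in let v := F ⟨p, ⟨k, n⟩⟩ in
    (j < N)%nat /\ (unr (ball i) < unr (ball (S i)))%nat /\
    (unr v <= unr (ball (S i)))%nat /\
    Rabs (point p - point (unl (ball i))) <= / 2 ^ S (unr (ball i)) /\
    INR z / 2 ^ N + / 2 ^ n <= Rabs (Q2R (rat_of_nat (unl v))) /\
    Rabs (Q2R (rat_of_nat (unl v))) + / 2 ^ n < INR z / 2 ^ N + / 2 ^ (4 * N)).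
  { intros k j i. specialize (Htest ⟨i, ball i⟩).
    change (ball (S i)) with (unl (g ⟨i, ball i⟩)).
    set (t := g ⟨i, ball i⟩) in *.
    rewrite <- (pair_unl_unr (ball i)), <- (pair_unl_unr t),
      <- (pair_unl_unr (unl t)), <- (pair_unl_unr (unr t)),
      <- (pair_unl_unr (unr (unr t))) in Htest.
    apply ball_test_spec in Htest. cbv zeta in Htest.
    exists (unl (unr t)), (unl (unr (unr t))), (unr (unr (unr t))). exact Htest. }
  assert (Hgrow : forall i, (unr (ball i) < unr (ball (S i)))%nat /\
    Rabs (point (unl (ball (S i))) - point (unl (ball i))) <= / 2 ^ S (unr (ball i))).
  { intros i. rewrite <- (pair_unl_unr i).
    destruct (Hstep (unl i) (unr i)) as [n [N [z H]]]. split; apply H. }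
  destruct (nested_balls (fun i => point (unl (ball i))) (fun i => / 2 ^ unr (ball i)))
    as [x Hx].
  { intros i. apply Rlt_le, Rinv_0_lt_compat, pow2_pos. }
  { intros i. destruct (Hgrow i) as [He Hp].
    apply inv_pow2_le in He. rewrite inv_pow2_S in He, Hp. lra. }
  cbv beta in Hx.
  assert (Hx01 : 0 < x < 1).
  { specialize (Hx 0%nat). unfold ball in Hx. simpl nat_rect in Hx.
    rewrite unl_pair, unr_pair in Hx.
    assert (Hp : point ⟨0%nat, 0%nat⟩ = / 2).
    { unfold point, den, num. rewrite unl_pair, unr_pair. simpl. lra. }
    rewrite Hp in Hx. apply Rabs_le_between in Hx. simpl in Hx. lra. }
  exists x. split; [exact Hx01|]. split.
  - destruct (computable_comp (fun s => point_code (unl s)) ball) as [c Hc]; trivial.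
    { apply computable_comp; auto using computable_point_code with computability. }
    exists c. intros i. exists (point_code (unl (ball i))). split; [apply Hc|].
    unfold approximates. rewrite Q2R_point_code.
    apply Rle_trans with (1 := Hx i), inv_pow2_le.
    (* Exponents grow strictly, so the [i]-th one is at least [i]. *)
    induction i as [|i IH]; [lia|]. destruct (Hgrow i) as [He _]. lia.
  (* [x] lies in the ball chosen at stage [⟨k, j⟩], on which the estimate of
     [phi k] recorded by the test is valid. *)
  - intros k. apply near_dyadics_not_normal. intros j.
    destruct (Hstep k j) as [n [N [z [HN [_ [Hu [_ [Hlo Hhi]]]]]]]].
    exists N, z. split; [exact HN|].
    set (i := ⟨k, j⟩) in *. set (p := unl (ball (S i))) in *.
    set (v := F ⟨p, ⟨k, n⟩⟩) in *.
    assert (Hv : approximates (unl v) n (phi k x)).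
    { apply Hcont; [exact Hx01|]. fold v.
      apply Rle_trans with (1 := Hx (S i)), inv_pow2_le, Hu. }
    unfold approximates in Hv. set (y := Q2R _) in *.
    assert (H1 := Rabs_triang_inv y (phi k x)).
    assert (H2 := Rabs_triang_inv (phi k x) y). rewrite Rabs_minus_sym in H2.
    unfold near_dyadic. lra.
Qed.
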